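(* Let $n$ and $i$ be integers $\geq 2$ with $i$ even, and $F$ any field. Let $y_n$ be an element in the kernel of $\tau_i:K^M_*(F)\to K^M_*(F)$, $x\mapsto\{-1\}^{i-1}\cdot x$. Then, for symbols $s_1,\ldots,s_l$ in $K^M_i(F)$, the formula $$(y_n\cdot\gamma_n)(s_1+\cdots+s_l)=y_n\cdot\sum_{1\leq l_1<\cdots<l_n\leq l}s_{l_1}\cdot\ldots\cdot s_{l_n}$$ gives a well-defined map on $K^M_i(F)$ with values in $K^M_*(F)$ (i.e. the right-hand side depends only on the element $s_1+\cdots+s_l$ of $K^M_i(F)$).
   Context: $K^M_*(F)=\bigoplus_{n\ge0}K^M_n(F)$ is the (integral) Milnor $K$-ring of $F$: the tensor algebra of the abelian group $F^\times$ modulo the ideal generated by the $a\otimes(1-a)$, $a\neq0,1$. The class of $a_1\otimes\cdots\otimes a_i$ is the symbol $\{a_1,\ldots,a_i\}\in K^M_i(F)$. Every element of $K^M_i(F)$ is a sum of symbols. *)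

(* Defs.v *)
From HB Require Import structures.
From mathcomp Require Import all_boot all_order all_algebra.
From mathcomp Require Import boolp finmap monalg.

Set Implicit Arguments.
Unset Strict Implicit.
Unset Printing Implicit Defensive.

Import GRing.Theory.
Local Open Scope ring_scope.
Local Open Scope quotient_scope.

(* Quotient of a (not necessarily commutative) ring by the two-sided ideal
   generated by P.  MathComp's {ideal_quot _} only covers commutative rings;
   the additive part is its {quot _}, and only the product is added here. *)
Section RingQuotient.
Variables (R : pzRingType) (P : R -> Prop).

Inductive ideal_gen : R -> Prop :=
| ideal_gen0 : ideal_gen 0
| ideal_genD a r b x : P r -> ideal_gen x -> ideal_gen (a * r * b + x).

Lemma ideal_gen_add x y : ideal_gen x -> ideal_gen y -> ideal_gen (x + y).
Proof.
move=> gx gy; elim: gx => [|a r b z Pr _ gz]; first by rewrite add0r.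
by rewrite -addrA; exact: ideal_genD.
Qed.

Lemma ideal_gen_opp x : ideal_gen x -> ideal_gen (- x).
Proof.
elim=> [|a r b z Pr _ gz]; first by rewrite oppr0; exact: ideal_gen0.
by rewrite opprD -!mulNr; exact: ideal_genD.
Qed.

Lemma ideal_gen_mull c x : ideal_gen x -> ideal_gen (c * x).
Proof.
elim=> [|a r b z Pr _ gz]; first by rewrite mulr0; exact: ideal_gen0.
by rewrite mulrDr !mulrA; exact: ideal_genD.
Qed.

Lemma ideal_gen_mulr c x : ideal_gen x -> ideal_gen (x * c).
Proof.
elim=> [|a r b z Pr _ gz]; first by rewrite mul0r; exact: ideal_gen0.
by rewrite mulrDl -mulrA; exact: ideal_genD.
Qed.

Definition ideal_pred : {pred R} := fun x => `[< ideal_gen x >].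

Lemma ideal_predP x : reflect (ideal_gen x) (x \in ideal_pred).
Proof. exact: asboolP. Qed.

Lemma ideal_pred_zmod_closed : zmod_closed ideal_pred.
Proof.
split=> [|x y /ideal_predP gx /ideal_predP gy]; apply/ideal_predP.
  exact: ideal_gen0.
by apply: ideal_gen_add => //; exact: ideal_gen_opp.
Qed.

HB.instance Definition _ :=
  GRing.isZmodClosed.Build R ideal_pred ideal_pred_zmod_closed.

Definition ring_quot : Type := Quotient.quot ideal_pred.

HB.instance Definition _ :=
  GRing.Zmodule.copy ring_quot (Quotient.quot ideal_pred).

Definition quot_class (x : R) : ring_quot := \pi_(Quotient.quot ideal_pred) x.
Definition quot_repr (u : ring_quot) : R :=
  repr (u : Quotient.quot ideal_pred).
Definition quot_one : ring_quot := quot_class 1.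
Definition quot_mul (u v : ring_quot) : ring_quot :=
  quot_class (quot_repr u * quot_repr v).

Lemma quot_reprK u : quot_class (quot_repr u) = u.
Proof. exact: reprK. Qed.

Lemma quot_classP x y : quot_class x = quot_class y <-> ideal_gen (x - y).
Proof.
split=> [/eqP|gxy].
  by rewrite /quot_class -Quotient.idealrBE => /ideal_predP.
by apply/eqP; rewrite /quot_class -Quotient.idealrBE; apply/ideal_predP.
Qed.

Lemma quot_class_zmod_morphism : zmod_morphism quot_class.
Proof.
by move=> x y; rewrite /quot_class [LHS](raddfB (\pi_(Quotient.quot ideal_pred))).
Qed.

HB.instance Definition _ :=
  GRing.isZmodMorphism.Build R ring_quot quot_class quot_class_zmod_morphism.

Lemma quot_classM x y :
  quot_class (x * y) = quot_mul (quot_class x) (quot_class y).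
Proof.
apply/quot_classP; set x' := quot_repr _; set y' := quot_repr _.
have /quot_classP gx : quot_class x = quot_class x' by rewrite quot_reprK.
have /quot_classP gy : quot_class y = quot_class y' by rewrite quot_reprK.
rewrite (_ : x * y - x' * y' = (x - x') * y + x' * (y - y')).
  by apply: ideal_gen_add; [exact: ideal_gen_mulr | exact: ideal_gen_mull].
by rewrite mulrBl mulrBr addrA subrK.
Qed.

Fact quot_mulA : associative quot_mul.
Proof.
move=> u v w; rewrite -[u]quot_reprK -[v]quot_reprK -[w]quot_reprK.
by do !rewrite -quot_classM; rewrite mulrA.
Qed.

Fact quot_mul1 : left_id quot_one quot_mul.
Proof. by move=> u; rewrite -[u]quot_reprK /quot_one -quot_classM mul1r. Qed.

Fact quot_mulr1 : right_id quot_one quot_mul.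
Proof. by move=> u; rewrite -[u]quot_reprK /quot_one -quot_classM mulr1. Qed.

Fact quot_mulDl : left_distributive quot_mul +%R.
Proof.
move=> u v w; rewrite -[u]quot_reprK -[v]quot_reprK -[w]quot_reprK.
by rewrite -raddfD -!quot_classM mulrDl raddfD.
Qed.

Fact quot_mulDr : right_distributive quot_mul +%R.
Proof.
move=> u v w; rewrite -[u]quot_reprK -[v]quot_reprK -[w]quot_reprK.
by rewrite -raddfD -!quot_classM mulrDr raddfD.
Qed.

HB.instance Definition _ := GRing.Zmodule_isPzRing.Build ring_quot
  quot_mulA quot_mul1 quot_mulr1 quot_mulDl quot_mulDr.

Lemma quot_class_monoid_morphism : monoid_morphism quot_class.
Proof. by split=> // x y; exact: quot_classM. Qed.

HB.instance Definition _ :=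
  GRing.isMonoidMorphism.Build R ring_quot quot_class quot_class_monoid_morphism.

End RingQuotient.

(* The tensor algebra over Z of an abelian group M: the free associative ring
   Z<M> (finite Z-combinations of words on M) modulo [a + b] = [a] + [b]. *)
Section TensorAlgebra.
Variable M : zmodType.

Local Notation free_ring := {malg int[{fmonom M}]}.

Definition free_gen (a : M) : free_ring := << fmu a >>.

Variant additivity_rel : free_ring -> Prop :=
  AdditivityRel a b :
    additivity_rel (free_gen (a + b) - (free_gen a + free_gen b)).

Definition tensor_alg : Type := ring_quot additivity_rel.
HB.instance Definition _ := GRing.PzRing.on tensor_alg.

Definition tensor_gen (a : M) : tensor_alg := quot_class _ (free_gen a).

(* The summand T^n(M) = M (x) ... (x) M of the tensor algebra. *)
Definition tensor_homog (n : nat) (x : tensor_alg) : Prop :=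
  exists2 w : free_ring,
    (forall m, m \in msupp w -> fdeg m = n) & x = quot_class _ w.

End TensorAlgebra.

(* The abelian group F^x, written additively as MathComp requires of a
   zmodType: a + b denotes the product in F and 0 denotes 1. *)
Record mulgrp (F : fieldType) := MulGrp {
  mulgrp_val :> F;
  mulgrp_neq0 : mulgrp_val != 0 }.

Section MultiplicativeGroup.
Variable F : fieldType.

HB.instance Definition _ := [isSub for @mulgrp_val F].
HB.instance Definition _ := [Choice of mulgrp F by <:].

Definition mulgrp_one : mulgrp F := MulGrp (oner_neq0 F).
Definition mulgrp_mul (a b : mulgrp F) : mulgrp F :=
  MulGrp (mulf_neq0 (mulgrp_neq0 a) (mulgrp_neq0 b)).
Definition mulgrp_inv (a : mulgrp F) : mulgrp F :=
  MulGrp (invr_neq0 (mulgrp_neq0 a)).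

Fact mulgrp_mulA : associative mulgrp_mul.
Proof. by move=> a b c; apply: val_inj; exact: mulrA. Qed.
Fact mulgrp_mulC : commutative mulgrp_mul.
Proof. by move=> a b; apply: val_inj; exact: mulrC. Qed.
Fact mulgrp_mul1 : left_id mulgrp_one mulgrp_mul.
Proof. by move=> a; apply: val_inj; exact: mul1r. Qed.
Fact mulgrp_mulV : left_inverse mulgrp_one mulgrp_inv mulgrp_mul.
Proof. by move=> a; apply: val_inj; exact: (mulVf (mulgrp_neq0 a)). Qed.

HB.instance Definition _ := GRing.isZmodule.Build (mulgrp F)
  mulgrp_mulA mulgrp_mulC mulgrp_mul1 mulgrp_mulV.

Definition mulgrp_N1 : mulgrp F :=
  MulGrp (etrans (congr1 negb (oppr_eq0 1)) (oner_neq0 F)).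

End MultiplicativeGroup.

Section MilnorK.
Variable F : fieldType.

(* Since a and b range over F^x, b = 1 - a amounts to a <> 0, 1. *)
Variant steinberg_rel : tensor_alg (mulgrp F) -> Prop :=
  SteinbergRel (a b : mulgrp F) :
    (b : F) = 1 - (a : F) -> steinberg_rel (tensor_gen a * tensor_gen b).

Definition milnorK : Type := ring_quot steinberg_rel.
HB.instance Definition _ := GRing.PzRing.on milnorK.

Definition milnorK_homog (n : nat) : {pred milnorK} :=
  fun x => `[< exists2 t, tensor_homog n t & x = quot_class _ t >].

Lemma milnorK_homog_zmod_closed n : zmod_closed (milnorK_homog n).
Proof.
split=> [|_ _ /asboolP[_ [u hu ->] ->] /asboolP[_ [v hv ->] ->]]; apply/asboolP.
  exists 0; last by rewrite raddf0.
  by exists 0; [move=> m; rewrite msupp0 inE | rewrite raddf0].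
rewrite -!raddfB; exists (quot_class (@additivity_rel _) (u - v)) => //.
exists (u - v) => // m /(fsubsetP (msuppB_le u v)).
by rewrite in_fsetU => /orP[/hu|/hv].
Qed.

HB.instance Definition _ n :=
  GRing.isZmodClosed.Build milnorK (milnorK_homog n)
    (milnorK_homog_zmod_closed n).

Record milnorKn (n : nat) := MilnorKn {
  milnorKn_val :> milnorK;
  milnorKn_homog : milnorKn_val \in milnorK_homog n }.

HB.instance Definition _ n := [isSub for @milnorKn_val n].
HB.instance Definition _ n := [Choice of milnorKn n by <:].
HB.instance Definition _ n := [SubChoice_isSubZmodule of milnorKn n by <:].

Definition symbol_val (n : nat) (a : n.-tuple (mulgrp F)) : milnorK :=
  quot_class _ (\prod_(x <- a) tensor_gen x).

Lemma symbol_val_homog n (a : n.-tuple (mulgrp F)) :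
  symbol_val a \in milnorK_homog n.
Proof.
apply/asboolP; exists (\prod_(x <- a) tensor_gen x) => //.
exists (\prod_(x <- a) free_gen x); last by rewrite rmorph_prod.
move=> m; rewrite -{2}(size_tuple a); elim: (tval a) m => [|x s IH] m /=.
  rewrite big_nil => /(fsubsetP (msuppC_le 1)).
  by rewrite in_fset1 => /eqP ->; exact: fdeg1.
rewrite big_cons => /msuppM_le[m1 [m2 [+ /IH hm2 ->]]].
by rewrite msuppU1 in_fset1 => /eqP ->; rewrite fdegM fdegU hm2.
Qed.

Definition symbol (n : nat) (a : n.-tuple (mulgrp F)) : milnorKn n :=
  MilnorKn (symbol_val_homog a).

Definition tau (i : nat) (x : milnorK) : milnorK :=
  (symbol [tuple mulgrp_N1 F] : milnorK) ^+ (i - 1) * x.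

End MilnorK.

(* Main.v *)
From HB Require Import structures.
Require Import Defs.
From mathcomp Require Import all_boot all_order all_algebra.
From mathcomp Require Import boolp finmap monalg.

(** The elementary symmetric functions of s_1, ..., s_l are the coefficients of
    the power series (1 + s_1 X) ... (1 + s_l X).  So it is enough to see that,
    after multiplication by y, the rule sending a symbol s to 1 + s X turns the
    sum of symbols in K_i into a product: it must respect the defining relations
    of K_i.

    A symbol that contains a Steinberg pair is 0 and goes to 1.  For additivity
    in one entry, let s = {c, a, d} and t = {c, b, d}, where c and d stand for
    the other i - 1 entries; then (1 + s X)(1 + t X) = 1 + (s + t) X + s t X^2,
    and one needs y s t = 0.  Generators of the Milnor ring anticommute and
    satisfy {a, a} = {-1, a}, hence
    s t = +- {a, b} {c, d} {c, d} = +- {-1}^(i-1) {a, b} {c, d},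
    and y kills it ([kword_mul_common_eq0]).  Since i is even, symbols in K_i are
    central ([even_kword_central]), so the order of the factors is irrelevant and
    y can be pulled through.

    To pass from the relations to all equalities in K_i, the free ring on words
    is used: two lists of words are identified when their products act in the
    same way on power series with coefficients in y K ([same_action]).  The
    differences of the sums of such lists form a subgroup of the free ring, which
    contains both ideals of relations ([multiplicative_null_additivity],
    [multiplicative_null_steinberg]).  Words are linearly independent in the free
    ring, and multiplication by 1 + s X is injective on power series; therefore
    two lists with the same sum in K have the same action ([same_action_kword]).
    Uniqueness of the map holds because every element of K_i is a sum of symbols
    ([milnorKn_sum_symbols]). *)

Set Implicit Arguments.
Unset Strict Implicit.
Unset Printing Implicit Defensive.

Import GRing.Theory.
Local Open Scope ring_scope.

(** * Products of linear power series *)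

Section PowerSeries.
Variable R : pzRingType.
Implicit Types (s t y : R) (u : nat -> R).

(** The series u * (1 + s X), for u given by its coefficients.  Acting on series
    from the right keeps the coefficients in a right ideal such as y K. *)
Definition mul1X s u : nat -> R :=
  fun k => if k is k'.+1 then u k + u k' * s else u 0.

(** The coefficients of u are recovered one after the other from those of
    u * (1 + s X); this gives cancellation without inverse series. *)
Lemma mul1X_inj s : injective (mul1X s).
Proof.
move=> u v uv; apply: funext; elim=> [|k IH]; first exact: (congr1 (@^~ 0) uv).
by have /= := congr1 (@^~ k.+1) uv; rewrite IH; exact: addIr.
Qed.

Lemma mul1XC s t u : GRing.comm s t ->
  mul1X s (mul1X t u) = mul1X t (mul1X s u).
Proof.
move=> st; apply: funext => -[|[|k]] //=; first by rewrite addrAC.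
by rewrite !mulrDl -!mulrA st addrACA.
Qed.

Lemma mul1X_mul s t u : (forall k, u k * (t * s) = 0) ->
  mul1X s (mul1X t u) = mul1X (s + t) u.
Proof.
move=> ust; rewrite [s + t]addrC; apply: funext => -[|[|k]] //=.
  by rewrite mulrDr addrA.
by rewrite !mulrDl -mulrA ust addr0 mulrDr addrA.
Qed.

Lemma mul1X0 u : mul1X 0 u = u.
Proof. by apply: funext => -[|k] //=; rewrite mulr0 addr0. Qed.

Definition const_series y : nat -> R := fun k => if k is 0 then y else 0.

Definition mul1Xs L u := foldr mul1X u L.

Lemma mul1Xs_cat L1 L2 u : mul1Xs (L1 ++ L2) u = mul1Xs L1 (mul1Xs L2 u).
Proof. exact: foldr_cat. Qed.

Lemma mul1Xs_inj L : injective (mul1Xs L).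
Proof. by elim: L => //= s L IH u v /mul1X_inj /IH. Qed.

Lemma mul1Xs_catC L1 L2 u : {in L1 & L2, forall s t, GRing.comm s t} ->
  mul1Xs L1 (mul1Xs L2 u) = mul1Xs L2 (mul1Xs L1 u).
Proof.
elim: L1 => //= s L1 IH cL; rewrite IH; last first.
  by move=> a b aL bL; apply: cL; rewrite // inE aL orbT.
have {IH cL} : {in L2, forall t, GRing.comm s t}.
  by move=> t tL; apply: cL; rewrite ?mem_head.
elim: L2 => //= t L2 IH cL; rewrite mul1XC; last by apply: cL; rewrite mem_head.
by rewrite IH // => a aL; apply: cL; rewrite inE aL orbT.
Qed.

Lemma mul1Xs_perm (T : eqType) (phi : T -> R) (L1 L2 : seq T) u :
    (forall a b, GRing.comm (phi a) (phi b)) -> perm_eq L1 L2 ->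
  mul1Xs (map phi L1) u = mul1Xs (map phi L2) u.
Proof.
move=> cphi; apply: (catCA_perm_subst (F := fun L => mul1Xs (map phi L) u)).
move=> M1 M2 M3; rewrite !map_cat !mul1Xs_cat; apply: mul1Xs_catC.
by move=> _ _ /mapP[a _ ->] /mapP[b _ ->].
Qed.

End PowerSeries.

(** * Elementary symmetric functions as sums over subsequences *)

Section Subsequences.
Variable T : eqType.
Implicit Types (s c : seq T).

(** This recursion on the list is the one satisfied by the coefficients of
    [mul1Xs] applied to a constant. *)
Fixpoint subseqs_of_size n s : seq (seq T) :=
  match n, s with
  | 0, _ => [:: [::]]
  | n'.+1, [::] => [::]
  | n'.+1, x :: s' =>
      map (cons x) (subseqs_of_size n' s') ++ subseqs_of_size n s'
  end.

Lemma mem_subseqs_of_size n s c :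
  uniq s -> (c \in subseqs_of_size n s) = (size c == n) && subseq c s.
Proof.
elim: s n c => [|x s IH] [|n] c /=.
- by rewrite inE; case: c.
- by case: c => [|a c] /=; rewrite ?andbF.
- by rewrite inE; case: c.
move=> /andP[xs us]; rewrite mem_cat IH //; case: c => [|z c] /=.
  by rewrite orbF; apply/mapP => -[].
rewrite eqSS; have [->|zx] := eqVneq z x.
  rewrite (mem_map (fun a b (e : x :: a = x :: b) => congr1 behead e)) IH //.
  case: (subseq (x :: c) s) / idP => [/mem_subseq/(_ x)|_]; last first.
    by rewrite andbF orbF.
  by rewrite mem_head (negPf xs) => /(_ isT).
suff /negPf-> : z :: c \notin map (cons x) (subseqs_of_size n s) by [].
by apply/mapP => -[d _ [/eqP]]; rewrite (negPf zx).
Qed.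

Lemma subseqs_of_size_uniq n s : uniq s -> uniq (subseqs_of_size n s).
Proof.
elim: s n => [|x s IH] [|n] //= /andP[xs us].
rewrite cat_uniq map_inj_uniq ?IH //; last by move=> a b [].
rewrite andbT; apply/hasPn => c; rewrite mem_subseqs_of_size // => /andP[_ cs].
apply/mapP => -[d _ cd]; move/mem_subseq/(_ x): cs.
by rewrite cd mem_head (negPf xs) => /(_ isT).
Qed.

(** Expanding y * (1 + phi x_1 X) ... (1 + phi x_l X): the coefficient of X^n is
    y times the n-th elementary symmetric function. *)
Lemma mul1Xs_const (R : pzRingType) (phi : T -> R) (y : R) s n :
    (forall x z, GRing.comm (phi x) z) ->
  mul1Xs (map phi s) (const_series y) n =
  y * \sum_(c <- subseqs_of_size n s) \prod_(x <- c) phi x.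
Proof.
move=> cphi; elim: s n => [|x s IH] [|n] /=.
- by rewrite big_seq1 big_nil mulr1.
- by rewrite big_nil mulr0.
- by rewrite IH /=; case: (s) => [|??]; rewrite big_seq1 big_nil.
rewrite !IH big_cat big_map /= addrC mulrDr; congr (_ + _).
rewrite -mulrA -cphi mulr_sumr; congr (_ * _).
by apply: eq_bigr => c _; rewrite big_cons.
Qed.

End Subsequences.

(** Strictly increasing tuples of indices are the subsequences of the increasing
    enumeration, because a sorted sequence is determined by its entries. *)
Lemma sum_sorted_tuples (V : nmodType) l n (G : seq 'I_l -> V) :
  \sum_(t : n.-tuple 'I_l | sorted ltn (map val t)) G t =
  \sum_(c <- subseqs_of_size n (enum 'I_l)) G c.
Proof.
rewrite -big_filter -(big_map val xpredT G).
apply: perm_big; apply: uniq_perm.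
- by rewrite map_inj_uniq ?filter_uniq ?index_enum_uniq //; exact: val_inj.
- by rewrite subseqs_of_size_uniq // enum_uniq.
move=> c; rewrite mem_subseqs_of_size ?enum_uniq //.
have ltnE (d : seq 'I_l) : sorted ltn (map val d) = sorted (relpre val ltn) d.
  by rewrite sorted_map.
have ltr : transitive (relpre (val : 'I_l -> nat) ltn).
  by move=> ? ? ?; exact: ltn_trans.
have enum_sorted : sorted (relpre val ltn) (enum 'I_l).
  by rewrite -ltnE val_enum_ord iota_ltn_sorted.
apply/mapP/andP => [[t] | [/eqP sc cs]].
  rewrite mem_filter ltnE => /andP[st _] ->; rewrite size_tuple eqxx.
  split=> //.
  have -> : val t = [seq x <- enum 'I_l | x \in t]; last exact: filter_subseq.
  apply: (irr_sorted_eq ltr) => [x| | |x] //; first exact: ltnn.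
    exact: (sorted_filter ltr).
  by rewrite mem_filter mem_enum andbT.
have tc : size c == n by apply/eqP.
exists (Tuple tc) => //; rewrite mem_filter ltnE mem_index_enum andbT.
exact: (subseq_sorted ltr cs).
Qed.

(** * Words in the free ring *)

Section FreeRing.
Variable M : zmodType.
Local Notation free_ring := {malg int[{fmonom M}]}.

Definition free_word (c : seq M) : free_ring := << FMonom c >>.

Lemma free_word_cat c d : free_word (c ++ d) = free_word c * free_word d.
Proof.
rewrite malgM_def fgmulUU mulr1; congr mkmalgU.
by apply/eqP; rewrite fmP fmM.
Qed.

Lemma free_word_nil : free_word [::] = 1.
Proof. by congr mkmalgU; apply/eqP; rewrite fmP fm1. Qed.

Lemma free_word1 a : free_word [:: a] = free_gen a.
Proof. by congr mkmalgU; rewrite fmuE. Qed.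

Lemma free_word_insert c a d :
  free_word (c ++ a :: d) = free_word c * free_gen a * free_word d.
Proof. by rewrite -cat1s !free_word_cat free_word1 mulrA. Qed.

Lemma free_ring_ind_supp (P : free_ring -> Prop) w :
    P 0 -> (forall x z, P x -> P z -> P (x - z)) ->
    (forall c, FMonom c \in msupp w -> P (free_word c)) -> P w.
Proof.
move=> P0 PB Pw.
have PN x : P x -> P (- x) by move=> Px; rewrite -sub0r; exact: PB.
have PD x z : P x -> P z -> P (x + z).
  by move=> Px Pz; rewrite -[z]opprK; apply: PB => //; exact: PN.
rewrite [w]monalgE big_seq; elim/big_ind: _ => // -[c] cw.
have PMn n : P (<< n%:R *g FMonom c >>).
  rewrite monalgUMn; elim: n => [|n IH]; first by rewrite mulr0n.
  by rewrite mulrS; apply: PD => //; exact: Pw.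
by case: (w@__) => n; rewrite ?NegzE ?monalgUN -natz; [|apply: PN].
Qed.

Lemma free_ring_ind (P : free_ring -> Prop) :
    P 0 -> (forall x z, P x -> P z -> P (x - z)) ->
    (forall c, P (free_word c)) -> forall w, P w.
Proof. by move=> P0 PB Pw w; apply: free_ring_ind_supp. Qed.

Lemma sum_free_word_inj (L L' : seq (seq M)) :
  \sum_(c <- L) free_word c = \sum_(c <- L') free_word c -> perm_eq L L'.
Proof.
move=> eqL; apply/allP => c _ /=; apply/eqP.
have coefE (L0 : seq (seq M)) :
    (\sum_(d <- L0) free_word d)@_(FMonom c) = (count_mem c L0)%:R.
  elim: L0 => [|d L0 IH]; first by rewrite big_nil mcoeff0.
  by rewrite big_cons mcoeffD mcoeffU1 fmP /= IH natrD.
by move: (congr1 (mcoeff (FMonom c)) eqL); rewrite !coefE !natz => -[].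
Qed.

End FreeRing.

(** * Words in anticommuting generators *)

Section AnticommutingFamily.
Variable R : pzRingType.
Implicit Types x z n : R.

(** Polarization of the identity x (x + n) = 0; in Milnor K-theory it is applied
    to {a, -a} = 0, with n = {-1}. *)
Lemma anticomm_of_isotropic x z n :
    x * (x + n) = 0 -> z * (z + n) = 0 -> (x + z) * (x + z + n) = 0 ->
  x * z = - (z * x).
Proof.
rewrite mulrDl !mulrDr => /eqP; rewrite addrC addr_eq0 => /eqP -> /eqP.
rewrite addrC addr_eq0 => /eqP -> /eqP.
by rewrite addrK [_ - x * x]addrAC subrr add0r addr_eq0 => /eqP.
Qed.

(** A sign does not affect whether a product vanishes; working up to sign avoids
    computing the parity of each reordering. *)
Definition eq_upto_sign x z := x = z \/ x = - z.

Lemma eq_upto_sign_trans x z t :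
  eq_upto_sign x z -> eq_upto_sign z t -> eq_upto_sign x t.
Proof. by move=> [->|->] [->|->]; rewrite /eq_upto_sign ?opprK; auto. Qed.

Lemma eq_upto_signM x z x' z' :
  eq_upto_sign x z -> eq_upto_sign x' z' -> eq_upto_sign (x * x') (z * z').
Proof.
by move=> [->|->] [->|->]; rewrite /eq_upto_sign ?mulrNN ?mulrN ?mulNr; auto.
Qed.

Variables (T : Type) (g : T -> R).
Hypothesis anticomm : forall a b, g a * g b = - (g b * g a).
Local Notation word c := (\prod_(a <- c) g a).

Lemma gen_mul_word a c : g a * word c = (-1) ^+ size c * (word c * g a).
Proof.
elim: c => [|b c IH]; first by rewrite big_nil !mul1r mulr1.
rewrite big_cons mulrA anticomm mulNr -[_ * g a * _]mulrA IH /= exprS.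
rewrite mulN1r mulNr.
by congr (- _); rewrite !mulrA; congr (_ * _ * _); rewrite commr_sign.
Qed.

Lemma even_word_comm c a : ~~ odd (size c) -> GRing.comm (word c) (g a).
Proof.
move=> ec; apply: commr_sym.
by rewrite /GRing.comm gen_mul_word -signr_odd (negPf ec) mul1r.
Qed.

Lemma word_gen_sign a c : eq_upto_sign (word c * g a) (g a * word c).
Proof.
rewrite /eq_upto_sign gen_mul_word -signr_odd.
by case: odd; [right; rewrite expr1 mulN1r opprK | left; rewrite mul1r].
Qed.

Lemma gen_word_square_sign a b c :
  eq_upto_sign (g a * word c * (g b * word c)) (g a * g b * (word c * word c)).
Proof.
rewrite -!mulrA; apply: eq_upto_signM; first by left.
by rewrite !mulrA; apply: eq_upto_signM; [exact: word_gen_sign | left].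
Qed.

Variable n : R.
Hypotheses (n_central : forall x, GRing.comm n x)
           (g_square : forall a, g a * g a = n * g a).

(** Each generator of the word meets its copy and leaves one factor n. *)
Lemma word_square c : eq_upto_sign (word c * word c) (n ^+ size c * word c).
Proof.
elim: c => [|a c IH]; first by left; rewrite big_nil mul1r.
rewrite big_cons; apply: eq_upto_sign_trans (gen_word_square_sign a a c) _.
have -> : n ^+ size (a :: c) * (g a * word c) =
          n * g a * (n ^+ size c * word c).
  rewrite /= exprS -!mulrA; congr (_ * _); rewrite !mulrA; congr (_ * _).
  exact/commr_sym/commrX/commr_sym/n_central.
by rewrite g_square; apply: eq_upto_signM => //; left.
Qed.

Lemma word_mul_common a b c d :
  eq_upto_sign (word (c ++ a :: d) * word (c ++ b :: d))
               (n ^+ size (c ++ d) * (g a * g b * word (c ++ d))).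
Proof.
have pull e : eq_upto_sign (word (c ++ e :: d)) (g e * word (c ++ d)).
  rewrite !big_cat big_cons /= !mulrA; apply: eq_upto_signM; last by left.
  exact: word_gen_sign.
apply: eq_upto_sign_trans (eq_upto_signM (pull a) (pull b)) _.
apply: eq_upto_sign_trans (gen_word_square_sign a b (c ++ d)) _.
set W := word (c ++ d).
have -> : n ^+ size (c ++ d) * (g a * g b * W) =
          g a * g b * (n ^+ size (c ++ d) * W).
  rewrite [LHS]mulrA [RHS]mulrA; congr (_ * _).
  exact/commr_sym/commrX/commr_sym/n_central.
by apply: eq_upto_signM; [left | exact: word_square].
Qed.

(** Two words that differ in one entry share all the others, and each shared
    entry contributes a factor n to their product. *)
Lemma word_mul_common_eq0 y a b c d : n ^+ size (c ++ d) * y = 0 ->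
  y * (word (c ++ a :: d) * word (c ++ b :: d)) = 0.
Proof.
set N := n ^+ _ => Ny0.
have cN z : GRing.comm N z by exact/commr_sym/commrX/commr_sym/n_central.
have z0 z : y * (N * z) = 0 by rewrite mulrA -cN Ny0 mul0r.
by case: (word_mul_common a b c d) => ->; rewrite ?mulrN z0 ?oppr0.
Qed.

End AnticommutingFamily.

(** * Generators and relations of the Milnor ring *)

Lemma quot_class_gen0 (R : pzRingType) (P : R -> Prop) r :
  P r -> quot_class P r = 0.
Proof.
move=> Pr; rewrite -(raddf0 (quot_class P)); apply/quot_classP.
rewrite subr0 -[r]addr0 -[r]mul1r -[1 * r]mulr1.
by apply: ideal_genD => //; exact: ideal_gen0.
Qed.

Section Symbols.
Variable F : fieldType.
Local Notation K := (milnorK F).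
Local Notation M := (mulgrp F).
Local Notation free_ring := {malg int[{fmonom (mulgrp F)}]}.
Local Notation N1 := (mulgrp_N1 F).

Definition kclass (w : free_ring) : K :=
  quot_class (@steinberg_rel F) (quot_class (@additivity_rel _) w).

Lemma kclassB x z : kclass (x - z) = kclass x - kclass z.
Proof. by rewrite /kclass !raddfB. Qed.

Lemma kclassM x z : kclass (x * z) = kclass x * kclass z.
Proof. by rewrite /kclass !rmorphM. Qed.

Definition kgen (a : M) : K := kclass (free_gen a).

Definition kword (c : seq M) : K := kclass (free_word c).

Lemma kword_cat c d : kword (c ++ d) = kword c * kword d.
Proof. by rewrite /kword free_word_cat kclassM. Qed.

Lemma kword_nil : kword [::] = 1.
Proof. by rewrite /kword free_word_nil /kclass !rmorph1. Qed.

Lemma kword_cons a c : kword (a :: c) = kgen a * kword c.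
Proof. by rewrite -cat1s kword_cat /kword free_word1. Qed.

Lemma symbolE n (s : n.-tuple M) : symbol s = kword s :> K.
Proof.
rewrite /= /symbol_val rmorph_prod /=; elim: (tval s) => [|a c IH].
  by rewrite big_nil kword_nil.
by rewrite big_cons kword_cons IH.
Qed.

Lemma kclass_surj (x : K) : exists w, x = kclass w.
Proof.
exists (quot_repr (quot_repr x : tensor_alg M)).
by rewrite /kclass !quot_reprK.
Qed.

Fact kgen_zmod_morphism : zmod_morphism kgen.
Proof.
move=> a b; apply/eqP; rewrite eq_sym subr_eq -{1}(subrK b a); apply/eqP.
set c := a - b; have e : tensor_gen (c + b) = tensor_gen c + tensor_gen b.
  have /quot_class_gen0/eqP := AdditivityRel c b.
  by rewrite raddfB subr_eq0 raddfD => /eqP.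
by rewrite [LHS](congr1 (quot_class (@steinberg_rel F)) e) raddfD.
Qed.
HB.instance Definition _ :=
  GRing.isZmodMorphism.Build M K kgen kgen_zmod_morphism.

Lemma kgenD a b : kgen (a + b) = kgen a + kgen b. Proof. exact: raddfD. Qed.

Lemma kword_additive c d a b :
  kword (c ++ (a + b) :: d) = kword (c ++ a :: d) + kword (c ++ b :: d).
Proof. by rewrite !kword_cat !kword_cons kgenD mulrDl mulrDr. Qed.

Lemma kgen_steinberg (a b : M) : (b : F) = 1 - (a : F) -> kgen a * kgen b = 0.
Proof.
by move=> ab; rewrite -rmorphM; apply: quot_class_gen0; exact: SteinbergRel.
Qed.

(** If a <> 1 then -a = (1 - a) / (1 - a^-1), and both {a, 1 - a} and
    {a, 1 - a^-1} = - {a^-1, 1 - a^-1} vanish. *)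
Lemma kgen_mul_opp (a : M) : kgen a * kgen (a + N1) = 0.
Proof.
have [a1|a1] := eqVneq (a : F) 1.
  by have -> : a = 0 by [apply: val_inj]; rewrite raddf0 mul0r.
have a'1 : (a : F)^-1 != 1 by rewrite -(inj_eq invr_inj) invrK invr1.
have b0 : 1 - (a : F) != 0 by rewrite subr_eq0 eq_sym.
have b'0 : 1 - (a : F)^-1 != 0 by rewrite subr_eq0 eq_sym.
have -> : a + N1 = MulGrp b0 - MulGrp b'0.
  apply: (addIr (MulGrp b'0)); rewrite subrK; apply: val_inj => /=.
  by rewrite mulrN1 mulrBr mulr1 mulNr mulfV ?mulgrp_neq0 // opprK addrC.
rewrite raddfB mulrBr kgen_steinberg // sub0r -mulNr -raddfN.
by rewrite kgen_steinberg.
Qed.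

Lemma kgen_anticomm (a b : M) : kgen a * kgen b = - (kgen b * kgen a).
Proof.
apply: (anticomm_of_isotropic (n := kgen N1)); rewrite -?kgenD;
  exact: kgen_mul_opp.
Qed.

Lemma kgen_square (a : M) : kgen a * kgen a = kgen N1 * kgen a.
Proof.
have := kgen_mul_opp a; rewrite raddfD mulrDr => /eqP.
by rewrite addr_eq0 -kgen_anticomm => /eqP.
Qed.

Lemma kgen_comm_central x : (forall a, GRing.comm x (kgen a)) ->
  forall z, GRing.comm x z.
Proof.
move=> cx z; have [w ->] := kclass_surj z.
elim/free_ring_ind: w => [|w1 w2 c1 c2|c].
- by rewrite /kclass !raddf0; exact: commr0.
- by rewrite kclassB; exact: (commrB c1 c2).
rewrite -/(kword c); elim: c => [|a c IH].
  by rewrite kword_nil; exact: commr1.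
by rewrite kword_cons; exact: (commrM (cx a) IH).
Qed.

Lemma kgenN1_central z : GRing.comm (kgen N1) z.
Proof.
apply: kgen_comm_central => a; rewrite /GRing.comm kgen_anticomm.
rewrite -mulrN -raddfN (_ : - N1 = N1) //.
by apply: val_inj; rewrite /= invrN invr1.
Qed.

Lemma kwordE c : kword c = \prod_(a <- c) kgen a.
Proof.
by elim: c => [|a c IH]; rewrite ?big_nil ?kword_nil // big_cons kword_cons IH.
Qed.

Lemma even_kword_central c : ~~ odd (size c) ->
  forall z, GRing.comm (kword c) z.
Proof.
move=> ec; apply: kgen_comm_central => a; rewrite kwordE.
exact: (even_word_comm kgen_anticomm).
Qed.

Lemma kword_mul_common_eq0 y a b c d : kgen N1 ^+ size (c ++ d) * y = 0 ->
  y * (kword (c ++ a :: d) * kword (c ++ b :: d)) = 0.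
Proof.
move=> Ny0; rewrite !kwordE.
exact: (word_mul_common_eq0 kgen_anticomm kgenN1_central kgen_square).
Qed.

End Symbols.

(** * Independence of the decomposition into symbols *)

Section WellDefined.
Variables (F : fieldType) (i : nat) (y : milnorK F).
Hypotheses (i_even : ~~ odd i) (y_kills : kgen (mulgrp_N1 F) ^+ i.-1 * y = 0).
Local Notation K := (milnorK F).
Local Notation M := (mulgrp F).
Local Notation free_ring := {malg int[{fmonom (mulgrp F)}]}.

(** Words of the wrong length are sent to 0, so that they act trivially; this
    extends the action of the symbols in K_i to the whole free ring, where the
    ideals of relations can be treated in all degrees at once. *)
Definition kword_deg (c : seq M) : K := if size c == i then kword c else 0.

Lemma kword_deg_central c z : GRing.comm (kword_deg c) z.
Proof.
rewrite /kword_deg; case: eqP => [ci|_]; last exact/commr_sym/commr0.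
by apply: even_kword_central; rewrite ci.
Qed.

Definition mult_series (u : nat -> K) := forall k, exists v, u k = y * v.

Lemma mult_series_mul1Xs L u : mult_series u ->
  mult_series (mul1Xs (map kword_deg L) u).
Proof.
move=> yu; elim: L => //= c L IH [|k] /=; first exact: IH.
have [v ->] := IH k.+1; have [v' ->] := IH k.
by exists (v + v' * kword_deg c); rewrite mulrDr mulrA.
Qed.

Definition same_action (L L' : seq (seq M)) := forall u, mult_series u ->
  mul1Xs (map kword_deg L) u = mul1Xs (map kword_deg L') u.

Lemma same_action_cat L1 L1' L2 L2' : same_action L1 L1' ->
  same_action L2 L2' -> same_action (L1 ++ L2) (L1' ++ L2').
Proof.
move=> e1 e2 u yu; rewrite !map_cat !mul1Xs_cat -e2 // e1 //.
exact: mult_series_mul1Xs.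
Qed.

Lemma same_action_perm L L' : perm_eq L L' -> same_action L L'.
Proof.
move=> pL u _.
exact: (mul1Xs_perm u (fun c d => kword_deg_central c (kword_deg d)) pL).
Qed.

(** Cancellation, from the injectivity of the action. *)
Lemma same_action_catI M1 M2 L L' : same_action M2 M1 ->
  same_action (M1 ++ L) (M2 ++ L') -> same_action L L'.
Proof.
move=> eM eL u yu; apply: (@mul1Xs_inj _ (map kword_deg M1)).
rewrite -mul1Xs_cat -map_cat eL // map_cat mul1Xs_cat eM //.
exact: mult_series_mul1Xs.
Qed.

(** The elements of the free ring on which the rule sending a sum of words to
    the product of the corresponding linear series gives the trivial action. *)
Definition multiplicative_null (w : free_ring) := exists L L',
  same_action L L' /\
  w = \sum_(c <- L) free_word c - \sum_(c <- L') free_word c.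

Lemma multiplicative_null0 : multiplicative_null 0.
Proof. by exists [::], [::]; split=> //; rewrite big_nil subr0. Qed.

Lemma multiplicative_nullB w1 w2 : multiplicative_null w1 ->
  multiplicative_null w2 -> multiplicative_null (w1 - w2).
Proof.
move=> [L1 [L1' [e1 ->]]] [L2 [L2' [e2 ->]]].
exists (L1 ++ L2'), (L1' ++ L2); split.
  by apply: same_action_cat => // u yu; rewrite e2.
by rewrite !big_cat /= opprB opprD addrACA.
Qed.

Lemma multiplicative_nullD w1 w2 : multiplicative_null w1 ->
  multiplicative_null w2 -> multiplicative_null (w1 + w2).
Proof.
move=> h1 h2; rewrite -[w2]opprK -[- w2]sub0r.
apply/multiplicative_nullB/multiplicative_nullB/h2 => //.
exact: multiplicative_null0.
Qed.

Lemma multiplicative_null_bimul r :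
    (forall c d, multiplicative_null (free_word c * r * free_word d)) ->
  forall w1 w2, multiplicative_null (w1 * r * w2).
Proof.
move=> hr w1 w2; elim/free_ring_ind: w1 => [|x z hx hz|c].
- by rewrite !mul0r; exact: multiplicative_null0.
- by rewrite !mulrBl; exact: (multiplicative_nullB hx hz).
elim/free_ring_ind: w2 => [|x z hx hz|d].
- by rewrite mulr0; exact: multiplicative_null0.
- by rewrite mulrBr; exact: (multiplicative_nullB hx hz).
exact: hr.
Qed.

(** This is where the hypothesis on y enters: the X^2 term of the product is
    killed by y. *)
Lemma same_action_additivity c d a b :
  same_action [:: c ++ (a + b) :: d] [:: c ++ a :: d; c ++ b :: d].
Proof.
move=> u yu /=; rewrite /kword_deg !size_cat /=.
case: eqP => [si|_]; last by rewrite !mul1X0.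
rewrite kword_additive; symmetry; apply: mul1X_mul => k; have [v ->] := yu k.
set w := kword _ * kword _; have w0 : y * w = 0.
  apply: kword_mul_common_eq0; rewrite size_cat.
  by rewrite -(_ : i.-1 = (size c + size d)%N) // -si addnS.
have even x : ~~ odd (size (c ++ x :: d)) by rewrite size_cat /= si.
have cw : GRing.comm v w.
  by apply: commrM; apply: commr_sym; apply: even_kword_central; exact: even.
by rewrite -mulrA cw mulrA w0 mul0r.
Qed.

Lemma same_action_steinberg c d (a b : M) : (b : F) = 1 - (a : F) ->
  same_action [:: c ++ [:: a; b] ++ d] [::].
Proof.
move=> ab u _ /=; rewrite /kword_deg; case: eqP => _; last by rewrite mul1X0.
rewrite kword_cat !kword_cons [kgen a * _]mulrA (kgen_steinberg ab) mul0r mulr0.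
exact: mul1X0.
Qed.

Lemma multiplicative_null_additivity w :
  ideal_gen (@additivity_rel M) w -> multiplicative_null w.
Proof.
elim=> [|w1 _ w2 x [a b] _ IH]; first exact: multiplicative_null0.
apply: multiplicative_nullD => //; apply: multiplicative_null_bimul => c d.
exists [:: c ++ (a + b) :: d], [:: c ++ a :: d; c ++ b :: d].
split; first exact: same_action_additivity.
rewrite big_seq1 big_cons big_seq1 !free_word_insert.
have distr (R : pzRingType) (p q1 q2 q3 r : R) :
    p * (q1 - (q2 + q3)) * r = p * q1 * r - (p * q2 * r + p * q3 * r).
  by rewrite mulrBr mulrDr mulrBl mulrDl.
exact: distr.
Qed.

(** The tensor algebra is itself a quotient, so an ideal element is followed
    through all its lifts to the free ring; two lifts differ by an element of
    the ideal of additivity relations. *)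
Lemma multiplicative_null_steinberg t : ideal_gen (@steinberg_rel F) t ->
  forall w, quot_class (@additivity_rel M) w = t -> multiplicative_null w.
Proof.
elim=> [|t1 r t2 z [a b ab] _ IH] w wt.
  apply: multiplicative_null_additivity; rewrite -[w]subr0.
  by apply/quot_classP; rewrite wt raddf0.
(* A lift of the given element, built from lifts of its ideal expression. *)
pose w' := quot_repr t1 * free_word [:: a; b] * quot_repr t2 + quot_repr z.
rewrite -[w](subrK w'); apply: multiplicative_nullD.
  apply/multiplicative_null_additivity/quot_classP.
  rewrite wt /w' rmorphD !rmorphM /= !quot_reprK.
  by rewrite -[[:: a; b]]cat1s free_word_cat !free_word1 rmorphM.
apply: multiplicative_nullD; last by apply: IH; rewrite quot_reprK.
apply: multiplicative_null_bimul => c d.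
exists [:: c ++ [:: a; b] ++ d], [::].
split; first exact: same_action_steinberg.
by rewrite big_seq1 big_nil subr0 !free_word_cat !mulrA.
Qed.

Lemma same_action_kword (L L' : seq (seq M)) :
  \sum_(c <- L) kword c = \sum_(c <- L') kword c -> same_action L L'.
Proof.
move=> eqL; pose w := \sum_(c <- L) free_word c - \sum_(c <- L') free_word c.
have kclass_sum L0 :
    kclass (\sum_(c <- L0) free_word c) = \sum_(c <- L0) kword c.
  by rewrite /kclass !raddf_sum.
have : kclass w = 0 by rewrite kclassB !kclass_sum eqL subrr.
rewrite -(raddf0 (quot_class (@steinberg_rel F))) => /quot_classP.
rewrite subr0 => /multiplicative_null_steinberg/(_ w erefl)[L1 [L1' [e1 ew]]].
apply: (same_action_catI e1) => u yu; apply: same_action_perm yu.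
apply: sum_free_word_inj; rewrite !big_cat /=.
move/eqP: ew; rewrite /w subr_eq => /eqP ->.
by rewrite addrA [_ + (_ - _)]addrCA subrr addr0.
Qed.

Lemma elementary_symmetric_well_defined n l l'
    (s : 'I_l -> i.-tuple M) (s' : 'I_l' -> i.-tuple M) :
    \sum_(j < l) symbol (s j) = \sum_(j < l') symbol (s' j) ->
  y * \sum_(t : n.-tuple 'I_l | sorted ltn (map val t))
        \prod_(j <- t) (symbol (s j) : K) =
  y * \sum_(t : n.-tuple 'I_l' | sorted ltn (map val t))
        \prod_(j <- t) (symbol (s' j) : K).
Proof.
have deg_symbol (t : i.-tuple M) : kword_deg t = symbol t.
  by rewrite /kword_deg size_tuple eqxx symbolE.
have actE m (r : 'I_m -> i.-tuple M) :
    y * \sum_(t : n.-tuple 'I_m | sorted ltn (map val t))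
        \prod_(j <- t) (symbol (r j) : K) =
    mul1Xs (map kword_deg [seq val (r j) | j <- enum 'I_m]) (const_series y) n.
  rewrite -map_comp mul1Xs_const => [|j z]; last exact: kword_deg_central.
  rewrite (sum_sorted_tuples n (fun t => \prod_(j <- t) (symbol (r j) : K))).
  congr (_ * _); apply: eq_bigr => c _; apply: eq_bigr => j _.
  by rewrite -deg_symbol.
have sumE m (r : 'I_m -> i.-tuple M) :
    val (\sum_(j < m) symbol (r j)) =
    \sum_(c <- [seq val (r j) | j <- enum 'I_m]) kword c.
  rewrite (raddf_sum val) big_map big_enum; apply: eq_bigr => j _.
  exact: symbolE.
move=> /(congr1 val); rewrite !sumE => /same_action_kword eL.
rewrite !actE eL //.
by case=> [|k]; [exists 1; rewrite mulr1 | exists 0; rewrite mulr0].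
Qed.

End WellDefined.

(** * Elements of K_i are sums of symbols *)

Section SumsOfSymbols.
Variables (F : fieldType) (i : nat).
Hypothesis i_gt0 : (0 < i)%N.
Local Notation M := (mulgrp F).

(** A symbol is negated by inverting its first entry, which exists as i > 0. *)
Lemma kword_opp (t : i.-tuple M) : exists t' : i.-tuple M, kword t' = - kword t.
Proof.
case: t => -[|a c] ci; first by case: i i_gt0 ci.
by exists (@Tuple i M (- a :: c) ci); rewrite /= !kword_cons raddfN mulNr.
Qed.

Lemma sum_kword_opp (L : seq (i.-tuple M)) : exists L' : seq (i.-tuple M),
  \sum_(t <- L') kword t = - \sum_(t <- L) kword t.
Proof.
elim: L => [|t L [L' eL']]; first by exists [::]; rewrite !big_nil oppr0.
have [t' et'] := kword_opp t.
by exists (t' :: L'); rewrite !big_cons opprD et' eL'.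
Qed.

Lemma milnorKn_sum_symbols (x : milnorKn F i) :
  exists l (s : 'I_l -> i.-tuple M), x = \sum_(j < l) symbol (s j).
Proof.
suff [L xL] : exists L : seq (i.-tuple M), x = \sum_(t <- L) symbol t.
  by exists (size L), (tnth (in_tuple L)); rewrite xL big_tnth.
case: x => x hx; have := hx; move/asboolP => [_ [w wi ->] xw].
suff [L wL] : exists L : seq (i.-tuple M), kclass w = \sum_(t <- L) kword t.
  exists L; apply: val_inj; rewrite (raddf_sum val) /= xw [LHS]wL.
  by apply: eq_bigr => t _; rewrite -symbolE.
pose sums v := exists L : seq (i.-tuple M), kclass v = \sum_(t <- L) kword t.
apply: (@free_ring_ind_supp _ sums) => [|w1 w2 [L1 e1] [L2 e2]|c cw].
- by exists [::]; rewrite /kclass !raddf0 big_nil.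
- have [L2' e2'] := sum_kword_opp L2.
  by exists (L1 ++ L2'); rewrite kclassB e1 e2 big_cat /= e2'.
by exists [:: Tuple (introT eqP (wi _ cw))]; rewrite big_seq1.
Qed.

End SumsOfSymbols.

Theorem proposition2p11 (n i : nat) (hn : (2 <= n)%N) (hi : (2 <= i)%N)
  (hieven : ~~ odd i) (F : fieldType) (y : milnorK F) (hy : tau i y = 0) :
  exists! f : milnorKn F i -> milnorK F,
    forall (l : nat) (s : 'I_l -> i.-tuple (mulgrp F)),
      f (\sum_(j < l) symbol (s j)) =
      y * \sum_(t : n.-tuple 'I_l | sorted ltn (map val t))
            \prod_(j <- t) (symbol (s j) : milnorK F).
Proof.
have y_kills : kgen (mulgrp_N1 F) ^+ i.-1 * y = 0.
  by move: hy; rewrite /tau symbolE /= kword_cons kword_nil mulr1 subn1.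
pose value (x : milnorKn F i) (z : milnorK F) :=
  exists l (s : 'I_l -> i.-tuple (mulgrp F)),
  x = \sum_(j < l) symbol (s j) /\
  z = y * \sum_(t : n.-tuple 'I_l | sorted ltn (map val t))
            \prod_(j <- t) (symbol (s j) : milnorK F).
have [f fP] : {f : milnorKn F i -> milnorK F & forall x, value x (f x)}.
  apply: choice => x; have [l [s xs]] := milnorKn_sum_symbols (ltnW hi) x.
  by eexists; exists l, s.
exists f; split=> [l s|g gP].
  have [l' [s' [e ->]]] := fP (\sum_(j < l) symbol (s j)).
  exact: (elementary_symmetric_well_defined hieven y_kills n (esym e)).
apply: funext => x; have [l [s [e ->]]] := fP x.
by rewrite e gP.
Qed.
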